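(* Let $d\le\omega$, let $I$ be a set, and for each $i\in I$ let $A_i$ be a Boolean algebra with the $d$-ary SFN. Then the coproduct (free product) $\bigoplus_{i\in I}A_i$ has the $d$-ary SFN.
   Context: Given subalgebras $C_0,\dots,C_{k-1}$ of $B$, let $P$ be the quotient of the free product $\bigoplus_{i<k}C_i$ (cofactor maps $\iota_i$) by the ideal generated by all $\iota_i(z)\wedge\iota_j(-z)$ with $z\in C_i\cap C_j$; $(C_i)_{i<k}$ commutes in $B$ if the unique homomorphism $P\to B$ extending the inclusions is injective. For $d\le\omega$, a Boolean algebra $A$ has the $d$-ary SFN if there is a family $\mathcal{E}$ of finite subalgebras of $A$, cofinal among finite subalgebras under inclusion, such that every tuple $B_0,\dots,B_{n-1}\in\mathcal{E}$ with $n<1+d$ commutes in $A$. *)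

(* Defs.v *)
From HB Require Import structures.
From mathcomp Require Import all_boot all_order.
From mathcomp Require Import generic_quotient.
From mathcomp Require Import boolp classical_sets cardinality.

Set Implicit Arguments.
Unset Strict Implicit.
Unset Printing Implicit Defensive.

Import Order.Theory.

Local Open Scope order_scope.
Local Open Scope quotient_scope.

(* Boolean algebras are the ctbDistrLatticeType's of MathComp.  The
   one-element algebra, in which \bot = \top, is one of them. *)

(* The library structure {tblmorphism _ -> _} only asks that \bot and \top be
   preserved, hence this predicate. *)
Definition ba_hom d (B : ctbDistrLatticeType d) d' (B' : ctbDistrLatticeType d')
    (f : B -> B') : Prop :=
  [/\ {morph f : x y / x `&` y}, {morph f : x y / x `|` y},
      {morph f : x / ~` x}, f \bot = \bot & f \top = \top].

(* A Boolean algebra up to an equivalence: the common data behind the two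
   quotients below (of terms by a congruence, of an algebra by an ideal). *)
Record preBA := PreBA {
  pre_sort : Type;
  pre_eq : pre_sort -> pre_sort -> Prop;
  pre_meet : pre_sort -> pre_sort -> pre_sort;
  pre_join : pre_sort -> pre_sort -> pre_sort;
  pre_compl : pre_sort -> pre_sort;
  pre_bot : pre_sort;
  pre_top : pre_sort;
  pre_refl : forall x, pre_eq x x;
  pre_sym : forall x y, pre_eq x y -> pre_eq y x;
  pre_trans : forall x y z, pre_eq x y -> pre_eq y z -> pre_eq x z;
  pre_meet_congr : forall x x' y y', pre_eq x x' -> pre_eq y y' ->
    pre_eq (pre_meet x y) (pre_meet x' y');
  pre_join_congr : forall x x' y y', pre_eq x x' -> pre_eq y y' ->
    pre_eq (pre_join x y) (pre_join x' y');
  pre_compl_congr : forall x x', pre_eq x x' ->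
    pre_eq (pre_compl x) (pre_compl x');
  pre_meetC : forall x y, pre_eq (pre_meet x y) (pre_meet y x);
  pre_joinC : forall x y, pre_eq (pre_join x y) (pre_join y x);
  pre_meetA : forall x y z,
    pre_eq (pre_meet x (pre_meet y z)) (pre_meet (pre_meet x y) z);
  pre_joinA : forall x y z,
    pre_eq (pre_join x (pre_join y z)) (pre_join (pre_join x y) z);
  pre_joinKI : forall x y, pre_eq (pre_meet x (pre_join x y)) x;
  pre_meetKU : forall x y, pre_eq (pre_join x (pre_meet x y)) x;
  pre_meetUl : forall x y z, pre_eq (pre_meet (pre_join x y) z)
    (pre_join (pre_meet x z) (pre_meet y z));
  pre_meetx1 : forall x, pre_eq (pre_meet x pre_top) x;
  pre_meet0x : forall x, pre_eq (pre_meet pre_bot x) pre_bot;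
  pre_joinxC : forall x, pre_eq (pre_join x (pre_compl x)) pre_top;
  pre_meetxC : forall x, pre_eq (pre_meet x (pre_compl x)) pre_bot
}.

Section PreBAQuotient.
Variable X : preBA.

Definition pre_eqb : rel {classic pre_sort X} :=
  fun x y => `[< @pre_eq X x y >].

Lemma pre_eqb_refl : reflexive pre_eqb.
Proof. by move=> x; apply/asboolP; apply: pre_refl. Qed.

Lemma pre_eqb_sym : symmetric pre_eqb.
Proof. by move=> x y; apply/asboolP/asboolP; apply: pre_sym. Qed.

Lemma pre_eqb_trans : transitive pre_eqb.
Proof.
by move=> y x z /asboolP xy /asboolP yz; apply/asboolP; apply: pre_trans yz.
Qed.

Canonical pre_equiv := EquivRel pre_eqb pre_eqb_refl pre_eqb_sym pre_eqb_trans.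

Definition preQ := {eq_quot pre_equiv}.
HB.instance Definition _ := Choice.on preQ.
HB.instance Definition _ := Quotient.on preQ.

Definition pre_pi (x : pre_sort X) : preQ := \pi_{eq_quot pre_equiv} x.
Definition pre_repr (q : preQ) : pre_sort X := repr q.

Lemma pre_reprK q : pre_pi (pre_repr q) = q.
Proof. exact: reprK. Qed.

Lemma pre_piP x y : pre_pi x = pre_pi y <-> pre_eq x y.
Proof.
split=> [|h]; first by move/eqmodP/asboolP.
by apply/eqmodP/asboolP.
Qed.

Lemma pre_reprP x : pre_eq (pre_repr (pre_pi x)) x.
Proof. by apply/pre_piP; rewrite pre_reprK. Qed.

Definition preQ_meet (p q : preQ) : preQ :=
  pre_pi (pre_meet (pre_repr p) (pre_repr q)).
Definition preQ_join (p q : preQ) : preQ :=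
  pre_pi (pre_join (pre_repr p) (pre_repr q)).
Definition preQ_compl (p : preQ) : preQ := pre_pi (pre_compl (pre_repr p)).
Definition preQ_bot : preQ := pre_pi (pre_bot X).
Definition preQ_top : preQ := pre_pi (pre_top X).

Lemma preQ_meetE x y : preQ_meet (pre_pi x) (pre_pi y) = pre_pi (pre_meet x y).
Proof. by apply/pre_piP; apply: pre_meet_congr; apply: pre_reprP. Qed.

Lemma preQ_joinE x y : preQ_join (pre_pi x) (pre_pi y) = pre_pi (pre_join x y).
Proof. by apply/pre_piP; apply: pre_join_congr; apply: pre_reprP. Qed.

Lemma preQ_complE x : preQ_compl (pre_pi x) = pre_pi (pre_compl x).
Proof. by apply/pre_piP; apply: pre_compl_congr; apply: pre_reprP. Qed.

Let preQE := (preQ_meetE, preQ_joinE, preQ_complE).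

Lemma preQ_ind (P : preQ -> Prop) : (forall x, P (pre_pi x)) -> forall q, P q.
Proof. by move=> h q; rewrite -[q]pre_reprK. Qed.

Lemma preQ_meetC : commutative preQ_meet.
Proof.
elim/preQ_ind=> x; elim/preQ_ind=> y; rewrite !preQE.
exact/pre_piP/pre_meetC.
Qed.

Lemma preQ_joinC : commutative preQ_join.
Proof.
elim/preQ_ind=> x; elim/preQ_ind=> y; rewrite !preQE.
exact/pre_piP/pre_joinC.
Qed.

Lemma preQ_meetA : associative preQ_meet.
Proof.
elim/preQ_ind=> x; elim/preQ_ind=> y; elim/preQ_ind=> z; rewrite !preQE.
exact/pre_piP/pre_meetA.
Qed.

Lemma preQ_joinA : associative preQ_join.
Proof.
elim/preQ_ind=> x; elim/preQ_ind=> y; elim/preQ_ind=> z; rewrite !preQE.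
exact/pre_piP/pre_joinA.
Qed.

Lemma preQ_joinKI (y x : preQ) : preQ_meet x (preQ_join x y) = x.
Proof.
elim/preQ_ind: x => x; elim/preQ_ind: y => y; rewrite !preQE.
exact/pre_piP/pre_joinKI.
Qed.

Lemma preQ_meetKU (y x : preQ) : preQ_join x (preQ_meet x y) = x.
Proof.
elim/preQ_ind: x => x; elim/preQ_ind: y => y; rewrite !preQE.
exact/pre_piP/pre_meetKU.
Qed.

Lemma preQ_meetUl : left_distributive preQ_meet preQ_join.
Proof.
elim/preQ_ind=> x; elim/preQ_ind=> y; elim/preQ_ind=> z; rewrite !preQE.
exact/pre_piP/pre_meetUl.
Qed.

Lemma preQ_meetxx : idempotent_op preQ_meet.
Proof. by move=> x; rewrite -{2}(preQ_meetKU x x) preQ_joinKI. Qed.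

Definition preQ_le : rel preQ := fun p q => preQ_meet p q == p.
Definition preQ_lt : rel preQ := fun p q => (q != p) && preQ_le p q.

HB.instance Definition _ :=
  @Order.isMeetJoinDistrLattice.Build (Order.Disp tt tt) preQ preQ_le preQ_lt
    preQ_meet preQ_join (fun _ _ => erefl) (fun _ _ => erefl)
    preQ_meetC preQ_joinC preQ_meetA preQ_joinA preQ_joinKI preQ_meetKU
    preQ_meetUl preQ_meetxx.

Lemma preQ_le0x (q : preQ) : preQ_bot <= q.
Proof.
elim/preQ_ind: q => x; apply/eqP; rewrite [LHS]preQ_meetE.
exact/pre_piP/pre_meet0x.
Qed.

Lemma preQ_lex1 (q : preQ) : q <= preQ_top.
Proof.
elim/preQ_ind: q => x; apply/eqP; rewrite [LHS]preQ_meetE.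
exact/pre_piP/pre_meetx1.
Qed.

HB.instance Definition _ :=
  @Order.hasBottom.Build (Order.Disp tt tt) preQ preQ_bot preQ_le0x.
HB.instance Definition _ :=
  @Order.hasTop.Build (Order.Disp tt tt) preQ preQ_top preQ_lex1.

Lemma preQ_joinxC (q : preQ) : q `|` preQ_compl q = \top.
Proof.
elim/preQ_ind: q => x; rewrite preQ_complE [LHS]preQ_joinE.
exact/pre_piP/pre_joinxC.
Qed.

Lemma preQ_meetxC (q : preQ) : q `&` preQ_compl q = \bot.
Proof.
elim/preQ_ind: q => x; rewrite preQ_complE [LHS]preQ_meetE.
exact/pre_piP/pre_meetxC.
Qed.

HB.instance Definition _ :=
  @Order.TBDistrLattice_hasComplement.Build (Order.Disp tt tt) preQ
    preQ_compl preQ_joinxC preQ_meetxC.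

Lemma pre_pi_meet x y : pre_pi (pre_meet x y) = pre_pi x `&` pre_pi y.
Proof. by rewrite -preQ_meetE. Qed.
Lemma pre_pi_join x y : pre_pi (pre_join x y) = pre_pi x `|` pre_pi y.
Proof. by rewrite -preQ_joinE. Qed.
Lemma pre_pi_compl x : pre_pi (pre_compl x) = ~` pre_pi x.
Proof. by rewrite -preQ_complE. Qed.
Lemma pre_pi_bot : pre_pi (pre_bot X) = \bot. Proof. by []. Qed.
Lemma pre_pi_top : pre_pi (pre_top X) = \top. Proof. by []. Qed.

End PreBAQuotient.

Section FreeProduct.
Variables (I : Type) (disp : I -> Order.disp_t).
Variable A : forall i, ctbDistrLatticeType (disp i).

Inductive fp_term : Type :=
| FpGen (i : I) (a : A i)
| FpMeet (s t : fp_term)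
| FpJoin (s t : fp_term)
| FpCompl (s : fp_term)
| FpBot
| FpTop.

(* The least congruence modulo which the terms form a Boolean algebra and
   every FpGen i is a homomorphism. *)
Inductive fp_eq : fp_term -> fp_term -> Prop :=
| fp_refl s : fp_eq s s
| fp_sym s t : fp_eq s t -> fp_eq t s
| fp_trans s t u : fp_eq s t -> fp_eq t u -> fp_eq s u
| fp_meet_congr s s' t t' : fp_eq s s' -> fp_eq t t' ->
    fp_eq (FpMeet s t) (FpMeet s' t')
| fp_join_congr s s' t t' : fp_eq s s' -> fp_eq t t' ->
    fp_eq (FpJoin s t) (FpJoin s' t')
| fp_compl_congr s s' : fp_eq s s' -> fp_eq (FpCompl s) (FpCompl s')
| fp_meetC s t : fp_eq (FpMeet s t) (FpMeet t s)
| fp_joinC s t : fp_eq (FpJoin s t) (FpJoin t s)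
| fp_meetA s t u : fp_eq (FpMeet s (FpMeet t u)) (FpMeet (FpMeet s t) u)
| fp_joinA s t u : fp_eq (FpJoin s (FpJoin t u)) (FpJoin (FpJoin s t) u)
| fp_joinKI s t : fp_eq (FpMeet s (FpJoin s t)) s
| fp_meetKU s t : fp_eq (FpJoin s (FpMeet s t)) s
| fp_meetUl s t u :
    fp_eq (FpMeet (FpJoin s t) u) (FpJoin (FpMeet s u) (FpMeet t u))
| fp_meetx1 s : fp_eq (FpMeet s FpTop) s
| fp_meet0x s : fp_eq (FpMeet FpBot s) FpBot
| fp_joinxC s : fp_eq (FpJoin s (FpCompl s)) FpTop
| fp_meetxC s : fp_eq (FpMeet s (FpCompl s)) FpBot
| fp_gen_meet i (a b : A i) :
    fp_eq (FpGen (a `&` b)) (FpMeet (FpGen a) (FpGen b))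
| fp_gen_join i (a b : A i) :
    fp_eq (FpGen (a `|` b)) (FpJoin (FpGen a) (FpGen b))
| fp_gen_compl i (a : A i) : fp_eq (FpGen (~` a)) (FpCompl (FpGen a))
| fp_gen_bot i : fp_eq (FpGen (\bot : A i)) FpBot
| fp_gen_top i : fp_eq (FpGen (\top : A i)) FpTop.

Definition fp_preBA : preBA :=
  PreBA fp_refl fp_sym fp_trans fp_meet_congr fp_join_congr fp_compl_congr
    fp_meetC fp_joinC fp_meetA fp_joinA fp_joinKI fp_meetKU fp_meetUl
    fp_meetx1 fp_meet0x fp_joinxC fp_meetxC.

Definition freeprod := preQ fp_preBA.
HB.instance Definition _ := Order.CTBDistrLattice.on freeprod.

Definition fp_in (i : I) (a : A i) : freeprod := @pre_pi fp_preBA (FpGen a).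

Lemma fp_in_hom i : ba_hom (@fp_in i).
Proof.
split=> [x y|x y|x||].
- rewrite /fp_in -pre_pi_meet; apply/pre_piP; exact: fp_gen_meet.
- rewrite /fp_in -pre_pi_join; apply/pre_piP; exact: fp_gen_join.
- rewrite /fp_in -pre_pi_compl; apply/pre_piP; exact: fp_gen_compl.
- apply/pre_piP; exact: fp_gen_bot.
- apply/pre_piP; exact: fp_gen_top.
Qed.

Section Lift.
Variables (d' : Order.disp_t) (B : ctbDistrLatticeType d').
Variable f : forall i, A i -> B.

Fixpoint fp_eval (t : fp_term) : B :=
  match t with
  | FpGen i a => f a
  | FpMeet s t => fp_eval s `&` fp_eval t
  | FpJoin s t => fp_eval s `|` fp_eval t
  | FpCompl s => ~` fp_eval s
  | FpBot => \bot
  | FpTop => \top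
  end.

Definition fp_lift (w : freeprod) : B := fp_eval (pre_repr w).

Hypothesis f_hom : forall i, ba_hom (@f i).

Lemma fp_eval_eq s t : fp_eq s t -> fp_eval s = fp_eval t.
Proof.
elim=> //=.
- by move=> ? ? ? _ -> _ ->.
- by move=> ? ? ? ? _ -> _ ->.
- by move=> ? ? ? ? _ -> _ ->.
- by move=> ? ? _ ->.
- by move=> ? ?; rewrite meetC.
- by move=> ? ?; rewrite joinC.
- by move=> ? ? ?; rewrite meetA.
- by move=> ? ? ?; rewrite joinA.
- by move=> ? ?; rewrite joinKI.
- by move=> ? ?; rewrite meetKU.
- by move=> ? ? ?; rewrite meetUl.
- by move=> ?; rewrite meetx1.
- by move=> ?; rewrite meet0x.
- by move=> ?; rewrite joinxC.
- by move=> ?; rewrite meetxC.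
- by move=> i a b; have [-> _ _ _ _] := f_hom i.
- by move=> i a b; have [_ -> _ _ _] := f_hom i.
- by move=> i a; have [_ _ -> _ _] := f_hom i.
- by move=> i; have [_ _ _ -> _] := f_hom i.
- by move=> i; have [_ _ _ _ ->] := f_hom i.
Qed.

Lemma fp_lift_pi (t : fp_term) : fp_lift (@pre_pi fp_preBA t) = fp_eval t.
Proof. by apply: fp_eval_eq; apply: (@pre_reprP fp_preBA). Qed.

Lemma fp_lift_in i (a : A i) : fp_lift (fp_in a) = f a.
Proof. exact: fp_lift_pi. Qed.

Lemma fp_lift_hom : ba_hom fp_lift.
Proof.
split.
- elim/(@preQ_ind fp_preBA)=> x; elim/(@preQ_ind fp_preBA)=> y.
  by rewrite -pre_pi_meet !fp_lift_pi.
- elim/(@preQ_ind fp_preBA)=> x; elim/(@preQ_ind fp_preBA)=> y.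
  by rewrite -pre_pi_join !fp_lift_pi.
- elim/(@preQ_ind fp_preBA)=> x.
  by rewrite -pre_pi_compl !fp_lift_pi.
- exact: (fp_lift_pi FpBot).
- exact: (fp_lift_pi FpTop).
Qed.

Lemma fp_lift_unique (h : freeprod -> B) :
  ba_hom h -> (forall i (a : A i), h (fp_in a) = f a) -> h = fp_lift.
Proof.
move=> [hI hU hC h0 h1] hin; apply/funext; elim/(@preQ_ind fp_preBA)=> t.
rewrite fp_lift_pi; elim: t => //=.
- by move=> s IHs t IHt; rewrite (@pre_pi_meet fp_preBA) hI IHs IHt.
- by move=> s IHs t IHt; rewrite (@pre_pi_join fp_preBA) hU IHs IHt.
- by move=> s IHs; rewrite (@pre_pi_compl fp_preBA) hC IHs.
Qed.

End Lift.
End FreeProduct.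

Section IdealQuotient.
Context {d : Order.disp_t} {B : ctbDistrLatticeType d}.

Definition is_ideal (J : set B) : Prop :=
  [/\ J \bot, (forall x y, J x -> J y -> J (x `|` y))
    & (forall x y, x <= y -> J y -> J x)].

Record ideal := Ideal {
  ideal_set :> B -> Prop;
  idealP : is_ideal ideal_set
}.

Lemma smallest_is_ideal (G : set B) : is_ideal (smallest is_ideal G).
Proof.
split=> [J [[]]//|x y Jx Jy J JG|x y xy Jy J JG].
- by case: (JG) => -[_ JU _] _; apply: JU; [exact: Jx | exact: Jy].
- by case: (JG) => -[_ _ JS] _; apply: (JS _ _ xy); exact: Jy.
Qed.

Definition ideal_gen (G : set B) : ideal := Ideal (smallest_is_ideal G).

Variable J : ideal.

Definition ideal_eq (x y : B) : Prop := J (x `\` y) /\ J (y `\` x).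

Lemma idealU x y : J x -> J y -> J (x `|` y).
Proof. by case: (idealP J) => _ + _; apply. Qed.

Lemma idealS x y : x <= y -> J y -> J x.
Proof. by case: (idealP J) => _ _; apply. Qed.

Lemma ideal0 : J \bot. Proof. by case: (idealP J). Qed.

Lemma idealDP x y : J (x `\` y) <-> exists2 j, J j & x <= y `|` j.
Proof.
split=> [h|[j Jj]]; first by exists (x `\` y); rewrite // -leBLR.
by rewrite -leBLR => /idealS; apply.
Qed.

Lemma ideal_eq_refl x : ideal_eq x x.
Proof. by split; rewrite diffxx; apply: ideal0. Qed.

Lemma ideal_eq_of x y : x = y -> ideal_eq x y.
Proof. by move=> ->; apply: ideal_eq_refl. Qed.

Lemma ideal_eq_sym x y : ideal_eq x y -> ideal_eq y x.
Proof. by case. Qed.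

Lemma idealD_trans x y z : J (x `\` y) -> J (y `\` z) -> J (x `\` z).
Proof.
move=> /idealDP [j Jj xy] /idealDP [k Jk yz]; apply/idealDP.
exists (k `|` j); first exact: idealU.
by rewrite joinA; apply: le_trans xy _; rewrite leU2.
Qed.

Lemma ideal_eq_trans x y z : ideal_eq x y -> ideal_eq y z -> ideal_eq x z.
Proof.
by move=> [xy yx] [yz zy]; split; [apply: idealD_trans yz | apply: idealD_trans yx].
Qed.

Lemma idealD_meet x x' y y' :
  J (x `\` x') -> J (y `\` y') -> J ((x `&` y) `\` (x' `&` y')).
Proof.
move=> /idealDP [j Jj xj] /idealDP [k Jk yk]; apply/idealDP.
exists (j `|` k); first exact: idealU.
rewrite joinIl lexI; apply/andP; split.
  by apply: le_trans (leIl _ _) _; apply: le_trans xj _; rewrite leU2 // leUl.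
by apply: le_trans (leIr _ _) _; apply: le_trans yk _; rewrite leU2 // leUr.
Qed.

Lemma idealD_join x x' y y' :
  J (x `\` x') -> J (y `\` y') -> J ((x `|` y) `\` (x' `|` y')).
Proof.
move=> /idealDP [j Jj xj] /idealDP [k Jk yk]; apply/idealDP.
by exists (j `|` k); [exact: idealU | rewrite joinACA leU2].
Qed.

Lemma idealD_compl x y : J (x `\` y) -> J (~` y `\` ~` x).
Proof. by rewrite !diffE complK meetC. Qed.

Lemma ideal_eq_meet x x' y y' : ideal_eq x x' -> ideal_eq y y' ->
  ideal_eq (x `&` y) (x' `&` y').
Proof. by move=> [? ?] [? ?]; split; apply: idealD_meet. Qed.

Lemma ideal_eq_join x x' y y' : ideal_eq x x' -> ideal_eq y y' ->
  ideal_eq (x `|` y) (x' `|` y').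
Proof. by move=> [? ?] [? ?]; split; apply: idealD_join. Qed.

Lemma ideal_eq_compl x x' : ideal_eq x x' -> ideal_eq (~` x) (~` x').
Proof. by move=> [? ?]; split; apply: idealD_compl. Qed.

Definition ideal_preBA : preBA :=
  PreBA ideal_eq_refl ideal_eq_sym ideal_eq_trans
    ideal_eq_meet ideal_eq_join ideal_eq_compl
    (fun x y => ideal_eq_of (meetC x y)) (fun x y => ideal_eq_of (joinC x y))
    (fun x y z => ideal_eq_of (meetA x y z))
    (fun x y z => ideal_eq_of (joinA x y z))
    (fun x y => ideal_eq_of (joinKI y x)) (fun x y => ideal_eq_of (meetKU y x))
    (fun x y z => ideal_eq_of (meetUl x y z))
    (fun x => ideal_eq_of (meetx1 x)) (fun x => ideal_eq_of (meet0x x))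
    (fun x => ideal_eq_of (joinxC x)) (fun x => ideal_eq_of (meetxC x)).

Definition quotBA := preQ ideal_preBA.
HB.instance Definition _ := Order.CTBDistrLattice.on quotBA.

Definition quot_pi (x : B) : quotBA := @pre_pi ideal_preBA x.

Lemma quot_pi_hom : ba_hom quot_pi.
Proof.
split=> [x y|x y|x||] //.
- exact: (@pre_pi_meet ideal_preBA).
- exact: (@pre_pi_join ideal_preBA).
- exact: (@pre_pi_compl ideal_preBA).
Qed.

Lemma quot_pi_surj (q : quotBA) : exists x, quot_pi x = q.
Proof. by exists (pre_repr q); apply: pre_reprK. Qed.

Lemma quot_pi_ker x : quot_pi x = \bot <-> J x.
Proof.
split=> [/pre_piP [] /=|Jx]; first by rewrite diffx0.
by apply/pre_piP; split; rewrite /= ?diffx0 // diff0x; apply: ideal0.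
Qed.

Section QuotLift.
Variables (d' : Order.disp_t) (C : ctbDistrLatticeType d') (g : B -> C).

Definition quot_lift (q : quotBA) : C := g (@pre_repr ideal_preBA q).

Hypotheses (g_hom : ba_hom g) (gJ : forall x, J x -> g x = \bot).

Lemma quot_lift_pi (x : B) : quot_lift (quot_pi x) = g x.
Proof.
have hD u v : J (u `\` v) -> g u <= g v.
  move=> /gJ guv; have [gI gU _ _ _] := g_hom.
  by rewrite -(joinIB v u) gU guv joinx0 gI leIr.
have [h1 h2] : ideal_eq (@pre_repr ideal_preBA (quot_pi x)) x.
  exact: (@pre_reprP ideal_preBA).
by apply/le_anti; rewrite !hD.
Qed.

Lemma quot_lift_hom : ba_hom quot_lift.
Proof.
have [gI gU gC g0 g1] := g_hom; have [pI pU pC p0 p1] := quot_pi_hom.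
split.
- move=> p q; have [x <-] := quot_pi_surj p; have [y <-] := quot_pi_surj q.
  by rewrite -pI !quot_lift_pi.
- move=> p q; have [x <-] := quot_pi_surj p; have [y <-] := quot_pi_surj q.
  by rewrite -pU !quot_lift_pi.
- by move=> p; have [x <-] := quot_pi_surj p; rewrite -pC !quot_lift_pi.
- by rewrite -p0 quot_lift_pi.
- by rewrite -p1 quot_lift_pi.
Qed.

Lemma quot_lift_unique (h : quotBA -> C) :
  (forall x, h (quot_pi x) = g x) -> h = quot_lift.
Proof.
move=> hg; apply/funext=> q; have [x <-] := quot_pi_surj q.
by rewrite hg quot_lift_pi.
Qed.

End QuotLift.
End IdealQuotient.

Section Subalgebra.
Context {d : Order.disp_t} {B : ctbDistrLatticeType d}.

Record subBA := SubBA {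
  subBA_set :> set B;
  subBA_bot : subBA_set \bot;
  subBA_top : subBA_set \top;
  subBA_meet : forall x y, subBA_set x -> subBA_set y -> subBA_set (x `&` y);
  subBA_join : forall x y, subBA_set x -> subBA_set y -> subBA_set (x `|` y);
  subBA_compl : forall x, subBA_set x -> subBA_set (~` x)
}.

Variable S : subBA.

Definition subBA_pred : pred B := fun x => x \in subBA_set S.

Record subBA_type := SubBAType {
  subBA_val : B;
  subBA_valP : subBA_pred subBA_val
}.

HB.instance Definition _ := [isSub for subBA_val].
HB.instance Definition _ := [Choice of subBA_type by <:].

Lemma subBA_val_inj : injective subBA_val.
Proof. exact: val_inj. Qed.

Lemma subBA_predE x : x \in subBA_pred <-> subBA_set S x.
Proof. by split=> [/set_mem|/mem_set]. Qed.

Lemma subBA_pred_meet : meet_closed subBA_pred.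
Proof. by move=> x y /subBA_predE ? /subBA_predE ?; apply/subBA_predE/subBA_meet. Qed.

Lemma subBA_pred_join : join_closed subBA_pred.
Proof. by move=> x y /subBA_predE ? /subBA_predE ?; apply/subBA_predE/subBA_join. Qed.

Lemma subBA_pred_bot : \bot \in subBA_pred.
Proof. exact/subBA_predE/subBA_bot. Qed.

Lemma subBA_pred_top : \top \in subBA_pred.
Proof. exact/subBA_predE/subBA_top. Qed.

HB.instance Definition _ :=
  @Order.SubChoice_isTBSubLattice.Build d B subBA_pred d subBA_type
    subBA_pred_meet subBA_pred_join subBA_pred_bot subBA_pred_top.

Lemma subBA_valI :
  {morph subBA_val : x y / (x : subBA_type) `&` y >-> x `&` y}.
Proof. exact: Order.valI_subproof. Qed.

Lemma subBA_valU :
  {morph subBA_val : x y / (x : subBA_type) `|` y >-> x `|` y}.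
Proof. exact: Order.valU_subproof. Qed.

Lemma subBA_val0 : subBA_val (\bot : subBA_type) = \bot.
Proof. exact: Order.val0_subproof. Qed.

Lemma subBA_val1 : subBA_val (\top : subBA_type) = \top.
Proof. exact: Order.val1_subproof. Qed.

Lemma subBA_type_meetUl :
  @left_distributive subBA_type subBA_type (@Order.meet _ _) (@Order.join _ _).
Proof.
by move=> x y z; apply: subBA_val_inj; rewrite !(subBA_valI, subBA_valU) meetUl.
Qed.

HB.instance Definition _ :=
  @Order.Lattice_Meet_isDistrLattice.Build d subBA_type subBA_type_meetUl.

Lemma subBA_pred_compl (x : subBA_type) : subBA_pred (~` subBA_val x).
Proof. by apply/mem_set/subBA_compl/set_mem/(subBA_valP x). Qed.

Definition subBA_type_compl (x : subBA_type) : subBA_type :=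
  SubBAType (subBA_pred_compl x).

Lemma subBA_type_joinxC (x : subBA_type) : x `|` subBA_type_compl x = \top.
Proof.
by apply: subBA_val_inj; rewrite subBA_valU subBA_val1 -(joinxC (subBA_val x)).
Qed.

Lemma subBA_type_meetxC (x : subBA_type) : x `&` subBA_type_compl x = \bot.
Proof.
by apply: subBA_val_inj; rewrite subBA_valI subBA_val0 -(meetxC (subBA_val x)).
Qed.

HB.instance Definition _ :=
  @Order.TBDistrLattice_hasComplement.Build d subBA_type
    subBA_type_compl subBA_type_joinxC subBA_type_meetxC.

Lemma subBA_val_hom : ba_hom subBA_val.
Proof.
exact: (And5 subBA_valI subBA_valU (fun _ => erefl) subBA_val0 subBA_val1).
Qed.

End Subalgebra.

Arguments subBA {d} B.

Section Commute.
Context {d : Order.disp_t} {B : ctbDistrLatticeType d}.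
Variables (K : Type) (C : K -> subBA B).

Definition sub_alg (i : K) : ctbDistrLatticeType d := subBA_type (C i).

Definition sub_val (i : K) (z : sub_alg i) : B := subBA_val z.

Definition sub_freeprod : Type := freeprod sub_alg.
HB.instance Definition _ := Order.CTBDistrLattice.on sub_freeprod.

Definition sub_in (i : K) (z : sub_alg i) : sub_freeprod :=
  @fp_in _ _ sub_alg i z.

(* The two copies y and z of one element of C i `&` C j have distinct types. *)
Definition amalg_rel : set sub_freeprod :=
  [set w | exists i j (y : sub_alg i) (z : sub_alg j),
     sub_val y = sub_val z /\ w = sub_in y `&` sub_in (~` z)].

Definition amalg : Type := quotBA (ideal_gen amalg_rel).
HB.instance Definition _ := Order.CTBDistrLattice.on amalg.

Definition amalg_in (i : K) (z : sub_alg i) : amalg :=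
  quot_pi _ (sub_in z).

Definition amalg_map : amalg -> B := quot_lift (fp_lift sub_val).

Let val_hom i : ba_hom (@sub_val i) := @subBA_val_hom _ _ (C i).

Lemma amalg_ker x : ideal_gen amalg_rel x -> fp_lift sub_val x = \bot.
Proof.
have [hI hU hC h0 h1] := fp_lift_hom val_hom.
apply: (@smallest_sub _ is_ideal amalg_rel
  [set x | fp_lift sub_val x = \bot]).
- split=> [|u v /= u0 v0|u v uv /= v0]; first exact: h0.
    by rewrite hU u0 v0 joinx0.
  by apply/eqP; rewrite -lex0 -v0 -(meet_l uv) hI leIr.
- move=> w [i [j [y [z [yz ->]]]]] /=; rewrite hI !fp_lift_in // yz.
  by have [_ _ -> _ _] := val_hom j; rewrite meetxC.
Qed.

Lemma amalg_map_in i (z : sub_alg i) :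
  amalg_map (amalg_in z) = sub_val z.
Proof.
rewrite /amalg_map quot_lift_pi ?fp_lift_in //; first exact: fp_lift_hom.
exact: amalg_ker.
Qed.

Lemma amalg_map_hom : ba_hom amalg_map.
Proof. by apply: quot_lift_hom; [exact: fp_lift_hom | exact: amalg_ker]. Qed.

Lemma amalg_map_unique (h : amalg -> B) :
  ba_hom h -> (forall i (z : sub_alg i), h (amalg_in z) = sub_val z) ->
  h = amalg_map.
Proof.
move=> [hI hU hC h0 h1] hin.
have [pI pU pC p0 p1] := quot_pi_hom (ideal_gen amalg_rel).
apply: quot_lift_unique => [||x]; [exact: fp_lift_hom|exact: amalg_ker|].
rewrite -(@fp_lift_unique _ _ _ _ _ _ val_hom (h \o quot_pi _)) //.
by split=> [u v|u v|u||] /=; rewrite ?pI ?pU ?pC ?p0 ?p1.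
Qed.

Definition commutes : Prop := injective amalg_map.

End Commute.

(* The ordinals d <= omega. *)
Variant ord_le_omega := OrdFin of nat | OrdOmega.

(* The order n < 1 + d between ordinals; 1 + omega is omega. *)
Definition lt_1plus (n : nat) (d : ord_le_omega) : bool :=
  match d with OrdFin m => (n < 1 + m)%N | OrdOmega => true end.

(* The tuple may be empty (n = 0): then amalg has two elements, so the
   one-element algebra does not have the r-ary SFN. *)
Definition sfn (r : ord_le_omega) d (A : ctbDistrLatticeType d) : Prop :=
  exists E : set (subBA A),
    [/\ forall S : subBA A, E S -> finite_set S,
        forall S : subBA A, finite_set S ->
          exists2 T : subBA A, E T & (S `<=` T)%classic
      & forall (n : nat) (C : 'I_n -> subBA A), lt_1plus n r ->
          (forall i, E (C i)) -> commutes C].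

(* Main.v *)
(* A homomorphism from the amalgam P of (C_k) to the two-element algebra 2 is a
   family of homomorphisms C_k -> 2 that agree on the overlaps.  By the Boolean
   prime ideal theorem, (C_k) therefore commutes in B iff every such family has
   a common extension B -> 2.  Homomorphisms from a free product to 2 are
   arbitrary families of homomorphisms from the factors, so this criterion is
   checked factor by factor for the subalgebras generated by finitely many
   members of the given cofinal families. *)

Require Import Defs.
From HB Require Import structures.
From mathcomp Require Import all_boot all_order.
From mathcomp Require Import boolp classical_sets cardinality.

Set Implicit Arguments.
Unset Strict Implicit.
Unset Printing Implicit Defensive.

Import Order.Theory.

Local Open Scope classical_set_scope.
Local Open Scope order_scope.

(** * Ultrafilters and homomorphisms to the two-element algebra *)

Section Filters.
Context {d : Order.disp_t} {B : ctbDistrLatticeType d}.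
Implicit Types U V : set B.

Definition proper_filter U : Prop :=
  [/\ U \top, ~ U \bot, (forall x y, U x -> U y -> U (x `&` y))
    & (forall x y, x <= y -> U x -> U y)].

Lemma proper_filter_maximal U : proper_filter U ->
  exists V, [/\ U `<=` V, proper_filter V
    & forall W, proper_filter W -> V `<=` W -> W `<=` V].
Proof.
move=> Uf; case: (Uf) => U1 U0 UI US.
(* Zorn's lemma must also accept the empty chain, whose union is empty. Hence the sets [X]
   considered are those that become proper filters after [U] is added. *)
have [|M [Mf Mmax]] := @Zorn_bigcup B [set X | proper_filter (X `|` U)%classic].
  move=> F FP Ftot; split=> [||x y|x y xy].
  - by right.
  - by case=> [[X FX X0]|//]; case: (FP _ FX) => _ + _ _; apply; left.
  - have step X u v : F X -> (X `|` U)%classic u -> (X `|` U)%classic v ->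
        (\bigcup_(Y in F) Y `|` U)%classic (u `&` v).
      move=> FX Xu Xv; case: (FP _ FX) => _ _ /(_ _ _ Xu Xv) [Xuv|Uuv] _.
        by left; exists X.
      by right.
    case=> [[X FX Xx]|Ux] [[Y FY Yy]|Uy].
    + by case: (Ftot _ _ FX FY) => XY;
        [apply: (step Y)|apply: (step X)] => //; left=> //; apply: XY.
    + by apply: (step X) => //; [left|right].
    + by apply: (step Y) => //; [right|left].
    + by right; apply: UI.
  - case=> [[X FX Xx]|Ux]; last by right; apply: US Ux.
    have Xx' : (X `|` U)%classic x by left.
    case: (FP _ FX) => _ _ _ /(_ _ _ xy Xx') [Xy|Uy]; last by right.
    by left; exists X.
exists (M `|` U)%classic; split=> //.
move=> W Wf MW; apply: contrapT => WM.
have WU : (W `|` U)%classic = W by apply: setUidl => x Ux; apply: MW; right.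
apply: (Mmax W); last by rewrite /= WU.
split; first by move=> x Mx; apply: MW; left.
by move=> WsM; apply: WM => x /WsM; left.
Qed.

Lemma ba_hom_bool (f : B -> bool) : {morph f : x y / x `&` y >-> x && y} ->
  {morph f : x / ~` x >-> ~~ x} -> ba_hom f.
Proof.
move=> fI fC; have f0 : f \bot = false.
  by rewrite -(meetxC (\bot : B)) fI fC; case: (f _).
split=> [x y|x y|x||] //; rewrite ?fI ?fC //.
- by rewrite -[x `|` y]complK complU fC fI !fC negb_and !negbK.
- by rewrite -compl0 fC f0.
Qed.

Lemma filter_extension U : proper_filter U ->
  exists2 f : B -> bool, ba_hom f & forall x, U x -> f x.
Proof.
move=> /proper_filter_maximal [V [UV [V1 V0 VI VS] Vmax]].
exists (fun x => `[< V x >]); last by move=> x Ux; apply/asboolP/UV.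
have VC x : ~ V x -> V (~` x).
  move=> Vx; apply: contrapT => Vcx; apply: Vx.
  (* This is the filter generated by [V] and [x]. It is proper because the complement of [x] is not
     in [V], so maximality puts [x] in [V]. *)
  apply: (Vmax [set y | exists2 v, V v & v `&` x <= y]).
  - split=> [||y z [v Vv vy] [w Vw wz]|y z yz [v Vv vy]].
    + by exists \top => //; apply: lex1.
    + case=> v Vv; rewrite lex0 => /eqP vx; apply: Vcx.
      by apply: VS Vv; rewrite -disj_leC // vx.
    + exists (v `&` w); first exact: VI.
      by rewrite lexI (le_trans _ vy) ?(le_trans _ wz) ?leI2 ?leIl ?leIr.
    + by exists v => //; apply: le_trans yz.
  - by move=> y Vy; exists y => //; apply: leIl.
  - by exists \top => //; apply: leIr.
apply: ba_hom_bool => [x y|x].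
- apply/asboolP/andP=> [Vxy|[/asboolP Vx /asboolP Vy]]; last exact: VI.
  by split; apply/asboolP; apply: VS Vxy; rewrite ?leIl ?leIr.
- rewrite -asbool_neg; apply/asboolP/asboolP=> [Vcx Vx|]; last exact: VC.
  by apply: V0; rewrite -(meetxC x); apply: VI.
Qed.

Lemma separating_hom (x : B) : x != \bot ->
  exists2 f : B -> bool, ba_hom f & f x.
Proof.
move=> x0; have [|f fh fU] := @filter_extension [set y | x <= y].
  split=> [||y z|y z yz]; rewrite /= ?lex1 ?lex0 //.
  - exact/negP.
  - by rewrite lexI => -> ->.
  - by move=> xy; apply: le_trans yz.
by exists f => //; apply: fU => /=.
Qed.

End Filters.

(** The images under [f] of the elements with [p] true generate a filter, which is proper because
    [f] sends only bottom to bottom. An ultrafilter above it also decides the elements with [p]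
    false, through their complements. *)
Lemma extend_along_injective d (B : ctbDistrLatticeType d)
    d' (B' : ctbDistrLatticeType d') (f : B -> B') (p : B -> bool) :
  ba_hom f -> injective f -> ba_hom p ->
  exists2 q : B' -> bool, ba_hom q & forall x, q (f x) = p x.
Proof.
move=> [fI fU fC f0 f1] finj [pI pU pC p0 p1].
have [|q qh qU] := @filter_extension _ _ [set y | exists2 x, p x & f x <= y].
  split=> [||y z [u pu uy] [v pv vz]|y z yz [u pu uy]].
  - by exists \top; rewrite ?p1 ?f1.
  - case=> x px; rewrite lex0 -f0 => /eqP /finj xE.
    by rewrite xE p0 in px.
  - by exists (u `&` v); rewrite ?pI ?pu ?pv // fI leI2.
  - by exists u => //; apply: le_trans yz.
exists q => // x; have [_ _ qC _ _] := qh.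
case px: (p x); first by apply: qU; exists x.
apply/negbTE; have -> : ~~ q (f x) = q (f (~` x)) by rewrite fC qC.
by apply: qU; exists (~` x) => //; rewrite pC px.
Qed.

(** * Commuting families and common extensions of two-valued homomorphisms *)

Definition hom_on d (B : ctbDistrLatticeType d) (S : set B) (p : B -> bool) :=
  {in S &, {morph p : x y / x `&` y >-> x && y}} /\
  {in S, {morph p : x / ~` x >-> ~~ x}}.

Section Criterion.
Context {d : Order.disp_t} {B : ctbDistrLatticeType d}.
Variables (K : Type) (C : K -> subBA B).

Lemma amalg_in_hom k : ba_hom (@amalg_in _ _ K C k).
Proof.
have [pI pU pC p0 p1] := quot_pi_hom (ideal_gen (amalg_rel (C := C))).
have [iI iU iC i0 i1] := @fp_in_hom _ _ (sub_alg C) k.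
by split=> [x y|x y|x||]; rewrite /amalg_in /sub_in ?(iI, iU, iC, i0, i1)
  ?(pI, pU, pC, p0, p1).
Qed.

(** The meet of one copy with the complement of the other is a generator of the ideal, which gives
    one inequality; the other follows by symmetry. *)
Lemma amalg_in_glue j k (y : sub_alg C j) (z : sub_alg C k) :
  sub_val y = sub_val z -> amalg_in y = amalg_in z.
Proof.
have le i l (u : sub_alg C i) (v : sub_alg C l) : sub_val u = sub_val v ->
    amalg_in u <= amalg_in v.
  move=> uv; have [_ _ iC _ _] := amalg_in_hom l.
  rewrite -[amalg_in v]complK -disj_leC -iC.
  have [pI _ _ _ _] := quot_pi_hom (ideal_gen (amalg_rel (C := C))).
  rewrite /amalg_in -pI; apply/eqP/quot_pi_ker.
  by move=> J [_]; apply; exists i, l, u, v.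
by move=> yz; apply/le_anti; rewrite !le.
Qed.

(** Every element of the amalgam is the class of a term in the generators, so induction on terms
    applies. The target is arbitrary so that it can be [bool]. *)
Lemma amalg_hom_ext d' (D : ctbDistrLatticeType d') (f g : amalg C -> D) :
  ba_hom f -> ba_hom g ->
  (forall k (z : sub_alg C k), f (amalg_in z) = g (amalg_in z)) -> f =1 g.
Proof.
move=> [fI fU fC f0 f1] [gI gU gC g0 g1] fg q.
have [pI pU pC p0 p1] := quot_pi_hom (ideal_gen (amalg_rel (C := C))).
have [x <-] := quot_pi_surj q.
elim/(@preQ_ind (fp_preBA (sub_alg C))): x; elim.
- exact: fg.
- move=> s IHs t IHt; rewrite (@pre_pi_meet (fp_preBA (sub_alg C))).
  by rewrite pI fI gI IHs IHt.
- move=> s IHs t IHt; rewrite (@pre_pi_join (fp_preBA (sub_alg C))).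
  by rewrite pU fU gU IHs IHt.
- move=> s IHs; rewrite (@pre_pi_compl (fp_preBA (sub_alg C))).
  by rewrite pC fC gC IHs.
- by rewrite pre_pi_bot p0 f0 g0.
- by rewrite pre_pi_top p1 f1 g1.
Qed.

(** Each [p k] is a total function on [B] whose values outside [C k] are left free, so agreement on
    overlaps is stated without passing between subalgebra types. *)
Definition extension_property : Prop := forall p : K -> B -> bool,
  (forall k, hom_on (C k) (p k)) ->
  (forall j k x, subBA_set (C j) x -> subBA_set (C k) x -> p j x = p k x) ->
  exists2 q : B -> bool, ba_hom q &
    forall k x, subBA_set (C k) x -> q x = p k x.

(** The family lifts to the free product, and agreement on overlaps makes the lift vanish on the
    ideal. The induced map on the amalgam then extends along the injection [amalg_map]. *)
Lemma commutes_extension : commutes C -> extension_property.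
Proof.
move=> inj p ph pp.
pose p' k (z : sub_alg C k) := p k (sub_val z).
have Cz k (z : sub_alg C k) : sub_val z \in (C k : set B) := subBA_valP z.
have p'h k : ba_hom (@p' k).
  have [pI pC] := ph k.
  have [vI _ vC _ _] := @subBA_val_hom _ _ (C k).
  by apply: ba_hom_bool => [x y|x]; rewrite /p' /sub_val ?vI ?vC ?pI ?pC //;
    exact: Cz.
have lh := fp_lift_hom p'h; case: (lh) => lI lU lC l0 l1.
have lJ x : ideal_gen (amalg_rel (C := C)) x -> fp_lift p' x = \bot.
  apply: (@smallest_sub _ is_ideal (amalg_rel (C := C))
    [set x | fp_lift p' x = \bot]).
  - split=> [|u v /= u0 v0|u v uv /= v0]; first exact: l0.
      by rewrite lU u0 v0.
    by apply/eqP; rewrite -lex0 -v0 -(meet_l uv) lI leIr.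
  - move=> w [i [j [y [z [yz ->]]]]] /=; rewrite lI /sub_in !fp_lift_in //.
    have [_ _ -> _ _] := p'h j; rewrite {1}/p' yz (pp i j) ?meetxC //.
      by rewrite -yz; apply/set_mem/Cz.
    exact/set_mem/Cz.
have [q qh qE] := extend_along_injective (amalg_map_hom C) inj
  (quot_lift_hom lh lJ).
exists q => // k x Ckx.
pose z : sub_alg C k := SubBAType (mem_set Ckx).
have := qE (amalg_in z); rewrite amalg_map_in quot_lift_pi //.
by rewrite fp_lift_in.
Qed.

(** A nonzero [x] in the kernel of [amalg_map] would be sent to true by some two-valued [f].
    Restricted to the cofactors, [f] is a compatible family; a common extension [q] gives [f] as [q]
    after [amalg_map], so [f x] is false. *)
Lemma extension_commutes : extension_property -> commutes C.
Proof.
move=> ext; case: (amalg_map_hom C) => mI mU mC m0 m1.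
suff ker (x : amalg C) : amalg_map x = \bot -> x = \bot.
  have le (x y : amalg C) : amalg_map x = amalg_map y -> x <= y.
    move=> xy; rewrite -[y]complK -disj_leC; apply/eqP/ker.
    by rewrite mI mC xy meetxC.
  by move=> x y xy; apply/le_anti; rewrite !le.
move=> mx; apply/eqP; apply: contraT => /separating_hom [f fh fx].
have [fI fU fC f0 f1] := fh.
(* Outside [C k] the value is false; on [C k] it is well determined because [z] is unique. *)
pose p k (b : B) := `[< exists2 z : sub_alg C k, sub_val z = b
  & f (amalg_in z) >].
have pE k (z : sub_alg C k) : p k (sub_val z) = f (amalg_in z).
  apply/asboolP/idP=> [[y /subBA_val_inj -> //]|fz]; by exists z.
have CE k b : subBA_set (C k) b -> exists z : sub_alg C k, sub_val z = b.
  by move=> Cb; exists (SubBAType (mem_set Cb)).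
have [k|j k b /CE [y yb] /CE [z zb]|q qh qp] := ext p.
- have [vI _ vC _ _] := @subBA_val_hom _ _ (C k).
  have [iI _ iC _ _] := amalg_in_hom k.
  split=> [x' y' /set_mem/CE [y <-] /set_mem/CE [z <-]|x' /set_mem/CE [y <-]].
  + by rewrite /sub_val -vI -!/(sub_val _) !pE iI fI.
  + by rewrite /sub_val -vC -!/(sub_val _) !pE iC fC.
- by rewrite -{1}yb -zb !pE (amalg_in_glue (y := y) (z := z)) // zb.
have [qI qU qC q0 q1] := qh.
have E : q \o amalg_map (C := C) =1 f.
  apply: amalg_hom_ext => //.
    by split=> [u v|u v|u||] /=; rewrite ?(mI, mU, mC, m0, m1) ?(qI, qU, qC).
  move=> k z /=; rewrite amalg_map_in (qp k) ?pE //.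
  exact/set_mem/(subBA_valP z).
by move: (E x); rewrite /= mx q0 fx.
Qed.

End Criterion.

(** * Generated subalgebras and their finiteness *)

Section Generated.
Context {d : Order.disp_t} {B : ctbDistrLatticeType d}.
Implicit Types (G : set B) (S : subBA B).

Lemma gen_subBA_subproof G :
  let X := [set x | forall S, G `<=` S -> subBA_set S x] in
  [/\ X \bot, X \top, forall x y, X x -> X y -> X (x `&` y),
      forall x y, X x -> X y -> X (x `|` y) & forall x, X x -> X (~` x)].
Proof.
split=> [S _|S _|x y Xx Xy S GS|x y Xx Xy S GS|x Xx S GS].
- exact: subBA_bot.
- exact: subBA_top.
- by apply: subBA_meet; [apply: Xx|apply: Xy].
- by apply: subBA_join; [apply: Xx|apply: Xy].
- by apply: subBA_compl; apply: Xx.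
Qed.

Definition gen_subBA G : subBA B :=
  let: And5 h0 h1 hI hU hC := gen_subBA_subproof G in SubBA h0 h1 hI hU hC.

Lemma gen_subBAE G x :
  subBA_set (gen_subBA G) x <-> forall S, G `<=` S -> subBA_set S x.
Proof. by rewrite /gen_subBA; case: gen_subBA_subproof. Qed.

Lemma sub_gen_subBA G : G `<=` gen_subBA G.
Proof. by move=> x Gx; apply/gen_subBAE => S; apply. Qed.

Lemma gen_subBA_min G S : G `<=` S -> gen_subBA G `<=` S.
Proof. by move=> GS x /gen_subBAE; apply. Qed.

Lemma gen_subBA_mono G H : G `<=` H -> gen_subBA G `<=` gen_subBA H.
Proof.
by move=> GH; apply: gen_subBA_min => x /GH; apply: sub_gen_subBA.
Qed.

Lemma finite_subBA_exists : exists S : subBA B, finite_set S.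
Proof.
pose X : set B := [set \bot; \top].
have h0 : X \bot by left.
have h1 : X \top by right.
have hI x y : X x -> X y -> X (x `&` y).
  by case=> -> [] ->; rewrite ?meet0x ?meet1x //.
have hU x y : X x -> X y -> X (x `|` y).
  by case=> -> [] ->; rewrite ?join0x ?join1x //.
have hC x : X x -> X (~` x).
  by case=> ->; rewrite ?compl0 ?compl1.
exists (SubBA h0 h1 hI hU hC) => /=.
by rewrite finite_setU; split; apply: finite_set1.
Qed.

Lemma adjoin_finite S (a : B) : finite_set S ->
  exists2 T : subBA B, finite_set T & S `<=` T /\ subBA_set T a.
Proof.
move=> Sfin.
(* The subalgebra generated by S and a is {(s & a) | (t & ~a) : s, t in S}. *)
pose h (u : B * B) := (u.1 `&` a) `|` (u.2 `&` ~` a).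
pose X := [set h u | u in (S : set B) `*` (S : set B)].
have hU (u v : B * B) : h u `|` h v = h (u.1 `|` v.1, u.2 `|` v.2).
  by rewrite /h /= !meetUl joinACA.
(* An element is determined by its parts below [a] and below the complement of [a]; the formula [hC]
   for complements is checked on these two parts. *)
have split_eq x y : x `&` a = y `&` a -> x `&` ~` a = y `&` ~` a -> x = y.
  by move=> xa xca; rewrite -[x]meetx1 -[y]meetx1 -(joinxC a) !meetUr xa xca.
have ha (u : B * B) : h u `&` a = u.1 `&` a.
  by rewrite meetUl -!meetA meetxx (meetC (~` a)) meetxC meetx0 joinx0.
have hca (u : B * B) : h u `&` ~` a = u.2 `&` ~` a.
  by rewrite meetUl -!meetA meetxx meetxC meetx0 join0x.
have complKI x b : ~` (x `&` b) `&` b = ~` x `&` b.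
  by rewrite complI meetUl (meetC (~` b)) meetxC joinx0.
have hC (u : B * B) : ~` (h u) = h (~` u.1, ~` u.2).
  apply: split_eq; rewrite ?ha ?hca /=.
    by rewrite -complKI ha complKI.
  by rewrite -complKI hca complKI.
have XU x y : X x -> X y -> X (x `|` y).
  move=> [u [u1 u2] <-] [v [v1 v2] <-]; rewrite hU.
  by exists (u.1 `|` v.1, u.2 `|` v.2) => //; split; apply: subBA_join.
have XC x : X x -> X (~` x).
  move=> [u [u1 u2] <-]; rewrite hC.
  by exists (~` u.1, ~` u.2) => //; split; apply: subBA_compl.
have XI x y : X x -> X y -> X (x `&` y).
  by move=> Xx Xy; rewrite -[x `&` y]complK complI; apply/XC/XU; apply: XC.
have SX : S `<=` X.
  by move=> x Sx; exists (x, x) => //; rewrite /h -meetUr joinxC meetx1.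
exists (SubBA (SX _ (subBA_bot S)) (SX _ (subBA_top S)) XI XU XC) => /=.
  by apply: finite_image; apply: finite_setX.
split=> //; exists (\top, \bot); last by rewrite /h meet1x meet0x joinx0.
by split; [apply: subBA_top|apply: subBA_bot].
Qed.

Lemma finite_sub_subBA G : finite_set G ->
  exists2 S : subBA B, finite_set S & G `<=` S.
Proof.
move=> /finite_seqP [s ->]; elim: s => [|a s [S Sfin sS]].
  by have [S Sfin] := finite_subBA_exists; exists S.
have [T Tfin [ST Ta]] := adjoin_finite a Sfin.
exists T => // x /=; rewrite inE => /predU1P [->//|xs].
exact/ST/sS.
Qed.

Lemma gen_subBA_finite G : finite_set G -> finite_set (gen_subBA G).
Proof.
move=> /finite_sub_subBA [S Sfin GS].
by apply: sub_finite_set Sfin; apply: gen_subBA_min.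
Qed.

(** The elements of the generated subalgebra on which [p] and [q] agree form a subalgebra containing
    [G]. *)
Lemma hom_on_gen_ext G (p q : B -> bool) : hom_on (gen_subBA G) p ->
  ba_hom q -> (forall x, G x -> q x = p x) ->
  forall x, subBA_set (gen_subBA G) x -> q x = p x.
Proof.
set S := gen_subBA G => -[pI pC] [qI qU qC q0 q1] qp.
pose X := [set x | subBA_set S x /\ q x = p x].
have XI x y : X x -> X y -> X (x `&` y).
  move=> [Sx qx] [Sy qy]; split; first exact: subBA_meet.
  by rewrite pI ?mem_set // qI qx qy.
have XC x : X x -> X (~` x).
  move=> [Sx qx]; split; first exact: subBA_compl.
  by rewrite pC ?mem_set // qC qx.
have XU x y : X x -> X y -> X (x `|` y).
  by move=> Xx Xy; rewrite -[x `|` y]complK complU; apply/XC/XI; apply: XC.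
(* [hom_on] does not mention bottom, so it is written as the meet of bottom with its complement. *)
have X0 : X \bot.
  have S0 := subBA_bot S; have Sc0 := subBA_compl S0.
  split=> //; rewrite -(meetxC (\bot : B)) qI qC pI ?pC ?mem_set //.
  by case: (q _); case: (p _).
have X1 : X \top by rewrite -compl0; apply: XC.
move=> x /(@gen_subBA_min _ (SubBA X0 X1 XI XU XC)) [] //= y Gy.
by split; [apply: sub_gen_subBA|apply: qp].
Qed.

End Generated.

(** * Finite supports in the free product *)

Section FreeProductSupport.
Variables (I : Type) (disp : I -> Order.disp_t).
Variable A : forall i, ctbDistrLatticeType (disp i).

(** Dependent pairs allow generators from different factors to be collected in one finite set. *)
Definition fp_gens (D : set {i & A i}) : set (freeprod A) :=
  [set w | exists i (a : A i), D (existT _ i a) /\ w = fp_in a].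

Lemma fp_gens_mono (D D' : set {i & A i}) : D `<=` D' ->
  gen_subBA (fp_gens D) `<=` gen_subBA (fp_gens D').
Proof.
move=> DD'; apply: gen_subBA_mono => _ [i [a [Da ->]]].
by exists i, a; split=> //; apply: DD'.
Qed.

Lemma fp_finite_support (w : freeprod A) :
  exists2 D : set {i & A i}, finite_set D & subBA_set (gen_subBA (fp_gens D)) w.
Proof.
elim/(@preQ_ind (fp_preBA A)): w; elim.
- move=> i a; exists [set existT _ i a]; first exact: finite_set1.
  by apply: sub_gen_subBA; exists i, a.
- move=> s [D Df Ds] t [D' D'f D't].
  exists (D `|` D')%classic; first by rewrite finite_setU.
  rewrite (@pre_pi_meet (fp_preBA A)); apply: subBA_meet.
    by apply: fp_gens_mono Ds; apply: subsetUl.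
  by apply: fp_gens_mono D't; apply: subsetUr.
- move=> s [D Df Ds] t [D' D'f D't].
  exists (D `|` D')%classic; first by rewrite finite_setU.
  rewrite (@pre_pi_join (fp_preBA A)); apply: subBA_join.
    by apply: fp_gens_mono Ds; apply: subsetUl.
  by apply: fp_gens_mono D't; apply: subsetUr.
- move=> s [D Df Ds]; exists D => //.
  by rewrite (@pre_pi_compl (fp_preBA A)); apply: subBA_compl.
- by exists set0; [exact: finite_set0|rewrite pre_pi_bot; apply: subBA_bot].
- by exists set0; [exact: finite_set0|rewrite pre_pi_top; apply: subBA_top].
Qed.

Lemma fp_finite_supportS (S : set (freeprod A)) : finite_set S ->
  exists2 D : set {i & A i}, finite_set D & S `<=` gen_subBA (fp_gens D).
Proof.
move=> Sfin.
have /choice [D DP] w : exists D : set {i & A i},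
    finite_set D /\ subBA_set (gen_subBA (fp_gens D)) w.
  by have [D Df Dw] := fp_finite_support w; exists D.
exists (\bigcup_(w in S) D w).
  by apply: bigcup_finite => // w _; case: (DP w).
move=> w Sw; by have [_] := DP w; apply: fp_gens_mono => u Du; exists w.
Qed.

Lemma finite_fiber (D : set {i & A i}) i : finite_set D ->
  finite_set [set a : A i | D (existT _ i a)].
Proof.
move=> Df.
(* The fiber lies in the image of [D] under [g], which transports the second component to [A i] when
   the index is [i] and takes the default value bottom otherwise. *)
pose g (u : {i & A i}) : A i :=
  if pselect (projT1 u = i) is left e then eq_rect _ A (projT2 u) _ e else \bot.
apply: sub_finite_set (finite_image g Df) => a Da; exists (existT _ i a) => //.
rewrite /g /=; case: pselect => // e.
by rewrite (Prop_irrelevance e erefl).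
Qed.

End FreeProductSupport.

(** * Transfer of the SFN from the factors to the free product *)

Lemma lt_1plusW m n d : (m <= n)%N -> lt_1plus n d -> lt_1plus m d.
Proof. by case: d => //= k; apply: leq_ltn_trans. Qed.

Theorem theorem6p11 (d : ord_le_omega) (I : Type) (disp : I -> Order.disp_t)
    (A : forall i : I, ctbDistrLatticeType (disp i)) :
  (forall i : I, sfn d (A i)) -> sfn d (freeprod A).
Proof.
move=> sfnA.
pose E i := projT1 (cid (sfnA i)).
have EP i := projT2 (cid (sfnA i)); rewrite -/(E _) in EP.
pose gens (F : set I) (T : forall i, subBA (A i)) : set (freeprod A) :=
  \bigcup_(i in F) [set fp_in a | a in (T i : set (A i))].
(* The family consists of the subalgebras generated by one member of [E i] for each [i] in a finite
   set [F]; the values of [T] outside [F] do not affect [gens F T]. *)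
exists [set S | exists (F : set I) (T : forall i, subBA (A i)),
  [/\ finite_set F, forall i, F i -> E i (T i) & S = gen_subBA (gens F T)]].
split.
- move=> _ [F [T [Ff ET ->]]]; apply: gen_subBA_finite.
  apply: bigcup_finite => // i /ET ETi; apply: finite_image.
  by have [Efin _ _] := EP i; apply: Efin.
- move=> S /fp_finite_supportS [D Df SD].
  (* Cofinality: the generators supporting [S] that come from the factor [i] are finitely many, so
     some member of [E i] contains them all. *)
  have ext i : exists2 T : subBA (A i), E i T &
      [set a : A i | D (existT _ i a)] `<=` T.
    have [T Tf DT] := finite_sub_subBA (finite_fiber i Df).
    have [_ /(_ T Tf) [T' ET' TT'] _] := EP i.
    by exists T' => //; apply: subset_trans TT'.
  pose T i := s2val (cid2 (ext i)).
  have ET i : E i (T i) by apply: (s2valP (cid2 (ext i))).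
  have DT i a : D (existT _ i a) -> subBA_set (T i) a.
    exact: (s2valP' (cid2 (ext i))).
  pose F := [set projT1 u | u in D].
  exists (gen_subBA (gens F T)).
    by exists F, T; split=> //; apply: finite_image.
  apply: subset_trans SD _; apply: gen_subBA_min => _ [i [a [Da ->]]].
  apply: sub_gen_subBA; exists i; first by exists (existT _ i a).
  by exists a => //; apply: DT.
- move=> n C nd /choice [F /choice [T FT]].
  have CE k : C k = gen_subBA (gens (F k) (T k)) by case: (FT k).
  have Cin k i a : F k i -> subBA_set (T k i) a -> subBA_set (C k) (fp_in a).
    by move=> Fi Ta; rewrite CE; apply: sub_gen_subBA; exists i => //; exists a.
  apply: extension_commutes => p ph pp.
  (* Only the indices [k] with [i] in [F k] constrain [q]. The corresponding [T k i] form a tuple of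
     length at most [n], which commutes in [A i]. If there are none, the empty tuple still provides
     a homomorphism. *)
  have ext i : exists2 q : A i -> bool, ba_hom q &
      forall k a, F k i -> subBA_set (T k i) a -> q a = p k (fp_in a).
    pose P : pred 'I_n := fun k => `[< F k i >].
    pose T' (j : 'I_#|P|) := T (enum_val j) i.
    have Fj (j : 'I_#|P|) : F (enum_val j) i by apply/asboolP/(enum_valP j).
    have [_ _ comm] := EP i.
    have /commutes_extension T'ext : commutes T'.
      apply: comm.
        by apply: lt_1plusW nd; rewrite -[leqRHS]card_ord max_card.
      by move=> j; have [_ + _] := FT (enum_val j); apply.
    have [j|j k a Tj Tk|q qh qp] :=
        T'ext (fun j a => p (enum_val j) (fp_in a)).
    + have [pI pC] := ph (enum_val j); have [iI _ iC _ _] := fp_in_hom A i.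
      have Tp a : a \in (T' j : set (A i)) ->
          fp_in a \in (C (enum_val j) : set (freeprod A)).
        by move=> /set_mem Ta; apply/mem_set/Cin.
      split=> [a b Ta Tb|a Ta] /=.
        by rewrite iI pI //; apply: Tp.
      by rewrite iC pC //; apply: Tp.
    + by apply: pp; apply: Cin.
    exists q => // k a Fk Ta.
    have Pk : k \in P by apply/asboolP.
    rewrite -[in RHS](enum_rankK_in Pk Pk); apply: qp.
    by rewrite /T' enum_rankK_in.
  pose q i := s2val (cid2 (ext i)).
  have qh i : ba_hom (q i) by apply: (s2valP (cid2 (ext i))).
  have qp i k a : F k i -> subBA_set (T k i) a -> q i a = p k (fp_in a).
    exact: (s2valP' (cid2 (ext i))).
  (* Homomorphisms from the factors combine with no compatibility condition, and agreement with
     [p k] need only be checked on the generators of [C k]. *)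
  exists (fp_lift q); first exact: fp_lift_hom.
  move=> k; rewrite CE; apply: hom_on_gen_ext.
  + by rewrite -CE.
  + exact: fp_lift_hom.
  by move=> _ [i Fi [a Ta <-]]; rewrite fp_lift_in //; apply: qp.
Qed.
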